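(* For any fixed integers $\omega>2$ and $d\ge2$ independent of $n$, StripIndependentSet is a 2-approximation algorithm for the Maximum Independent Set problem in $d$-dimensional Line of Sight networks with range parameter $\omega$: on any such network embedded in $\mathbb{Z}^d_n$ it runs in time polynomial in $n$ and returns an independent set whose total weight is at least half of the maximum total weight of an independent set.
   Context: $\mathbb{Z}^d_n=\{1,\dots,n\}^d$. Two distinct points share a line of sight if their coordinates differ in exactly one place. A vertex-weighted graph $G=(V,E,w)$ (positive weights) is a $d$-dimensional Line of Sight (LoS) network with range parameter $\omega$ if there is an embedding (injective map) $f_G:V\to\mathbb{Z}^d_n$ such that $\{u,v\}\in E$ if and only if $f_G(u)$ and $f_G(v)$ share a line of sight and their Manhattan distance is less than $\omega$. The network is given together with its embedding. The Maximum Independent Set (MIS) problem asks for an independent set maximizing the sum of the weights of its elements. StripIndependentSet: let $k=\omega-1$. For each index vector $(i_1,\dots,i_{d-1})$ with $i_h\in\{1,\dots,\lceil n/k\rceil\}$, the strip with that index is the subgraph of $G$ induced by the vertices embedded at points of $\mathbb{Z}^d_n$ of the form $(k(i_1-1)+j_1,\dots,k(i_{d-1}-1)+j_{d-1},i_d)$ with $j_h\in\{1,\dots,k\}$ for $h\in\{1,\dots,d-1\}$ and $i_d\in\{1,\dots,n\}$. A strip is odd (resp. even) if $\sum_{h=1}^{d-1}i_h$ is odd (resp. even). An optimal (maximum total weight) independent set is computed in each strip by an exact dynamic programming algorithm whose running time on such strips is polynomial in $n$ for fixed $k$, $d$ and $\omega$. The algorithm returns the set of larger total weight among: the union of the independent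 sets found in all odd strips, and the union of the independent sets found in all even strips. *)

(* Defs.v *)
From HB Require Import structures.
From mathcomp Require Import all_boot all_order all_algebra.

Set Implicit Arguments.
Unset Strict Implicit.
Unset Printing Implicit Defensive.

Import Order.TTheory GRing.Theory Num.Theory.

Local Open Scope nat_scope.

(* {1, ..., n}^d is the set of d-tuples of naturals satisfying [in_grid n]:
   coordinates are 1-based. *)
Definition in_grid (n d : nat) (p : d.-tuple nat) : bool :=
  all (fun x => 0 < x <= n) p.

Definition share_line_of_sight (d : nat) (p q : d.-tuple nat) : bool :=
  #|[set h : 'I_d | tnth p h != tnth q h]| == 1.

Definition manhattan (d : nat) (p q : d.-tuple nat) : nat :=
  \sum_(h < d) `|tnth p h - tnth q h|.

(* A network always carries its embedding.  [los_edgeE] makes the edge relation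
   symmetric and irreflexive. *)
Record los_network (R : realFieldType) (d omega n : nat) := LosNetwork {
  los_vertex :> finType;
  los_edge : rel los_vertex;
  los_weight : los_vertex -> R;
  los_embed : los_vertex -> d.-tuple nat;
  los_weight_gt0 : forall v, (0 < los_weight v)%R;
  los_embed_grid : forall v, in_grid n (los_embed v);
  los_embed_inj : injective los_embed;
  los_edgeE : forall u v, los_edge u v =
    share_line_of_sight (los_embed u) (los_embed v)
    && (manhattan (los_embed u) (los_embed v) < omega)
}.

Section Independence.
Variables (R : realFieldType) (d omega n : nat) (G : los_network R d omega n).

Definition independent (I : {set G}) : bool :=
  [forall u in I, forall v in I, ~~ los_edge u v].

Definition weight (I : {set G}) : R := (\sum_(v in I) los_weight v)%R.

(* The default value 0 is the weight of the empty independent set. *)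
Definition max_independent_weight : R :=
  \big[Num.max/0%R]_(I : {set G} | independent I) weight I.

(* [I] is an optimal independent set of the subgraph induced by [A]. *)
Definition optimal_independent_in (A I : {set G}) : Prop :=
  [/\ I \subset A, independent I &
      forall J : {set G}, J \subset A -> independent J ->
        (weight J <= weight I)%R].

End Independence.

(* Running times.  Algorithms are written in a monad pairing a value with the
   number of elementary steps spent computing it.  The model is the unit-cost
   RAM: arithmetic and comparison of integers and of weights, reading a
   coordinate or a weight of a vertex, querying an edge and allocating or
   inspecting one list cell each take constant time.  Every list traversal is
   charged for every cell; a constant amount of work may be absorbed in a single
   unit. *)
Definition timed (A : Type) : Type := (A * nat)%type.
Definition value (A : Type) (x : timed A) : A := x.1.
Definition time (A : Type) (x : timed A) : nat := x.2.

Definition charge (c : nat) (A : Type) (a : A) : timed A := (a, c).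

Definition bind (A B : Type) (x : timed A) (f : A -> timed B) : timed B :=
  (value (f (value x)), time x + time (f (value x))).

Notation "'let*' x ':=' a 'in' b" := (bind a (fun x => b))
  (at level 200, x name, a at level 100, b at level 200,
   format "'[v' 'let*'  x  ':='  a  'in' '/' b ']'").

Fixpoint foldT (A B : Type) (f : A -> B -> timed B) (s : seq A) (b : B)
    : timed B :=
  if s is x :: s' then
    let* b1 := f x b in
    let* b2 := foldT f s' b1 in
    charge 1 b2
  else charge 1 b.

Fixpoint filterT (A : Type) (p : A -> timed bool) (s : seq A)
    : timed (seq A) :=
  if s is x :: s' then
    let* b := p x in
    let* r := filterT p s' in
    charge 1 (if b then x :: r else r)
  else charge 1 [::].

Fixpoint allT (A : Type) (p : A -> timed bool) (s : seq A) : timed bool :=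
  if s is x :: s' then
    let* b := p x in
    let* r := allT p s' in
    charge 1 (b && r)
  else charge 1 true.

(* Union of two disjoint sets given as lists; the order is irrelevant. *)
Definition unionT (A : Type) (s1 s2 : seq A) : timed (seq A) :=
  foldT (fun x acc => charge 1 (x :: acc)) s1 s2.

Fixpoint eq_seqT (T : eqType) (s1 s2 : seq T) : timed bool :=
  match s1, s2 with
  | x1 :: s1', x2 :: s2' =>
      if x1 == x2 then let* r := eq_seqT s1' s2' in charge 1 r
      else charge 1 false
  | [::], [::] => charge 1 true
  | _, _ => charge 1 false
  end.

Section Strips.

Definition ceil_div (n k : nat) : nat := (n + k.-1) %/ k.

(* [i] is an index vector (i_1, ..., i_(d-1)) with 1 <= i_h <= ceil(n / k). *)
Definition strip_index (d n k : nat) (i : seq nat) : bool :=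
  (size i == d.-1) && all (fun ih => 0 < ih <= ceil_div n k) i.

(* The h-th coordinate, for h <= d - 1, is k (i_h - 1) + j for some j in
   {1, ..., k}; the last coordinate is unconstrained. *)
Definition in_strip (d k : nat) (i : seq nat) (p : d.-tuple nat) : bool :=
  all2 (fun ih ph => ph \in [seq k * (ih - 1) + j | j <- iota 1 k])
       i (take d.-1 p).

Variables (R : realFieldType) (d omega n : nat) (G : los_network R d omega n).

Definition strip (i : seq nat) : {set G} :=
  [set v | in_strip omega.-1 i (los_embed v)].

Definition strip_listT (i : seq nat) : timed (seq G) :=
  filterT (fun v => charge (d * omega.-1) (in_strip omega.-1 i (los_embed v)))
          (enum G).

End Strips.

Arguments strip {R d omega n} G i.
Arguments strip_listT {R d omega n} G i.

(* A strip solver receives the network and the duplicate-free list of the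
   vertices of one of its strips, and returns a list of vertices. *)
Definition strip_solver (R : realFieldType) (d omega : nat) : Type :=
  forall (n : nat) (G : los_network R d omega n), seq G -> timed (seq G).

Section Solvers.
Variables (R : realFieldType) (d omega : nat) (solve : strip_solver R d omega).

Definition exact_strip_solver : Prop :=
  forall (n : nat) (G : los_network R d omega n) (i : seq nat),
    strip_index d n omega.-1 i ->
    let s := value (solve (value (strip_listT G i))) in
    uniq s /\ optimal_independent_in (strip G i) [set v in s].

(* The polynomial may depend on d and omega, but not on the network. *)
Definition polytime_strip_solver : Prop :=
  exists p : {poly nat},
    forall (n : nat) (G : los_network R d omega n) (i : seq nat),
      strip_index d n omega.-1 i ->
      time (solve (value (strip_listT G i))) <= p.[n]%R.

End Solvers.

Section StripIndependentSet.
Variables (R : realFieldType) (d omega : nat) (solve : strip_solver R d omega).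
Variables (n : nat) (G : los_network R d omega n).

(* All lists of length r with entries in {1, ..., m}. *)
Fixpoint index_vectorsT (m r : nat) : timed (seq (seq nat)) :=
  if r is r'.+1 then
    let* ts := index_vectorsT m r' in
    foldT (fun a acc => foldT (fun t acc' => charge 1 ((a :: t) :: acc')) ts acc)
          (iota 1 m) [::]
  else charge 1 [:: [::]].

Definition weightT (s : seq G) : timed R :=
  foldT (fun v acc => charge 1 (acc + los_weight v)%R) s 0%R.

(* [acc.1] collects the odd strips, [acc.2] the even ones. *)
Definition collect_stripT (i : seq nat) (acc : seq G * seq G)
    : timed (seq G * seq G) :=
  let* s := strip_listT G i in
  let* I := solve s in
  let* b := charge d (odd (sumn i)) in
  if b then let* u := unionT I acc.1 in charge 1 (u, acc.2)
  else let* u := unionT I acc.2 in charge 1 (acc.1, u).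

Definition StripIndependentSet : timed (seq G) :=
  let* idx := index_vectorsT (ceil_div n omega.-1) d.-1 in
  let* acc := foldT collect_stripT idx ([::], [::]) in
  let* w_odd := weightT acc.1 in
  let* w_even := weightT acc.2 in
  charge 1 (if (w_even <= w_odd)%R then acc.1 else acc.2).

End StripIndependentSet.

(* A dynamic program for strips.  The vertices are scanned by increasing last
   coordinate.  A state is the trace of a partial independent set on the scanned
   vertices whose last coordinate is within omega of the current one (no other
   scanned vertex can be adjacent to a vertex yet to come); for each state a
   partial solution of largest weight is kept. *)
Record partial_solution (R : realFieldType) (V : Type) := PartialSolution {
  ps_state : seq V;
  ps_weight : R;
  ps_set : seq V
}.

Section StripDP.
Variables (R : realFieldType) (d omega n : nat) (G : los_network R d omega n).

Local Notation psol := (partial_solution R G).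

Definition last_coord (v : G) : nat := last 0 (los_embed v).

Fixpoint tabulateT (c : psol) (table : seq psol) : timed (seq psol) :=
  if table is c' :: table' then
    let* b := eq_seqT (ps_state c) (ps_state c') in
    if b then
      charge 1 ((if (ps_weight c' < ps_weight c)%R then c else c') :: table')
    else
      let* r := tabulateT c table' in
      charge 1 (c' :: r)
  else charge 1 [:: c].

(* Both ways of extending [c] past [v]: leaving [v] out, or adding it if it has
   no neighbour in the state. *)
Definition extendT (v : G) (c : psol) (table : seq psol) : timed (seq psol) :=
  let* st := filterT
    (fun u => charge 1 (last_coord v < last_coord u + omega)) (ps_state c) in
  let* table1 := tabulateT (PartialSolution st (ps_weight c) (ps_set c)) table in
  let* free := allT (fun u => charge 1 (~~ los_edge u v)) st in
  if free then
    tabulateT (PartialSolution (v :: st) (ps_weight c + los_weight v)%R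
                               (v :: ps_set c)) table1
  else charge 1 table1.

Definition scan_vertexT (v : G) (table : seq psol) : timed (seq psol) :=
  foldT (extendT v) table [::].

Definition scan_layerT (s : seq G) (t : nat) (table : seq psol)
    : timed (seq psol) :=
  let* layer := filterT (fun v => charge 1 (last_coord v == t)) s in
  foldT scan_vertexT layer table.

Definition best_of (c c' : psol) : psol :=
  if (ps_weight c' < ps_weight c)%R then c else c'.

Definition strip_dp_on (s : seq G) : timed (seq G) :=
  let init := PartialSolution [::] 0%R [::] : psol in
  let* table := foldT (scan_layerT s) (iota 1 n) [:: init] in
  let* best := foldT (fun c c' => charge 1 (best_of c c')) table init in
  charge 1 (ps_set best).

End StripDP.

Definition strip_dp (R : realFieldType) (d omega : nat)
    : strip_solver R d omega :=
  fun n G s => strip_dp_on s.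

Arguments strip_dp R d omega : clear implicits.

(* A polynomial-time rho-approximation algorithm for maximum (weight) independent
   set in LoS networks given with their embedding, for fixed d and omega. *)
Definition polytime_approximation (R : realFieldType) (d omega : nat) (rho : R)
    (alg : forall n (G : los_network R d omega n), timed (seq G)) : Prop :=
  (exists p : {poly nat},
     forall (n : nat) (G : los_network R d omega n),
       time (alg n G) <= p.[n]%R)
  /\ (forall (n : nat) (G : los_network R d omega n),
        let S := [set v in value (alg n G)] in
        independent S
        /\ (max_independent_weight G / rho <= weight S)%R).

(* Main.v *)
(** Adjacent vertices differ in one coordinate, by at most [k = omega - 1].  If
    they lie in different strips, exactly one entry of the strip index differs,
    and it differs by one: the two strips have opposite parities.  So the union
    of independent sets of the odd (resp. even) strips is independent, and it is
    optimal among the independent sets of odd (resp. even) vertices.  Every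
    independent set splits into an odd and an even part, hence the factor 2.

    The dynamic program is correct because a vertex whose last coordinate is at
    distance [omega] or more from the current one has no neighbour to come.  The
    window of a strip lies in a box of side [omega], so it contains at most
    [omega ^ d] vertices and a table has at most [2 ^ (omega ^ d)] states. *)

Require Import Defs.
From HB Require Import structures.
From mathcomp Require Import all_boot all_order all_algebra.
From mathcomp Require Import zify.

Set Implicit Arguments.
Unset Strict Implicit.
Unset Printing Implicit Defensive.

Import Order.TTheory GRing.Theory Num.Theory.

Local Open Scope nat_scope.

(** * Closure properties of polynomially bounded cost functions *)

Definition poly_bounded (f : nat -> nat) : Prop :=
  exists p : {poly nat}, forall n, f n <= p.[n]%R.

Lemma poly_bounded_const c : poly_bounded (fun=> c).
Proof. by exists (c%:P)%R => n; rewrite hornerC. Qed.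

Lemma poly_bounded_id : poly_bounded id.
Proof. by exists 'X%R => n; rewrite hornerX. Qed.

Lemma poly_bounded_horner (p : {poly nat}) :
  poly_bounded (fun n => p.[n]%R).
Proof. by exists p. Qed.

Lemma poly_boundedD f g :
  poly_bounded f -> poly_bounded g -> poly_bounded (fun n => f n + g n).
Proof.
by move=> [p fp] [q gq]; exists (p + q)%R => n; rewrite hornerD leq_add.
Qed.

Lemma poly_boundedM f g :
  poly_bounded f -> poly_bounded g -> poly_bounded (fun n => f n * g n).
Proof.
by move=> [p fp] [q gq]; exists (p * q)%R => n; rewrite hornerM leq_mul.
Qed.

Lemma poly_boundedS f : poly_bounded f -> poly_bounded (fun n => (f n).+1).
Proof.
move=> /(poly_boundedD (poly_bounded_const 1))[p fp].
by exists p => n; apply: fp.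
Qed.

Lemma poly_boundedX f m :
  poly_bounded f -> poly_bounded (fun n => f n ^ m).
Proof.
move=> fP; elim: m => [|m IHm]; first exact: poly_bounded_const.
case: (poly_boundedM fP IHm) => p le_p; exists p => n.
by rewrite expnS le_p.
Qed.

Ltac solve_poly_bounded :=
  repeat first [ apply: poly_bounded_const | apply: poly_bounded_id
               | apply: poly_bounded_horner | apply: poly_boundedS
               | apply: poly_boundedD | apply: poly_boundedM
               | apply: poly_boundedX ].

(** * Values and costs of the timed list operations *)

Lemma time_bind (A B : Type) (x : timed A) (f : A -> timed B) :
  time (bind x f) = time x + time (f (value x)).
Proof. by []. Qed.

Lemma value_bind (A B : Type) (x : timed A) (f : A -> timed B) :
  value (bind x f) = value (f (value x)).
Proof. by []. Qed.

Section Folds.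
Variables (A B : Type) (f : A -> B -> timed B).

Lemma value_foldT s b :
  value (foldT f s b) = foldl (fun b x => value (f x b)) b s.
Proof. by elim: s b => //= x s IHs b; rewrite -IHs. Qed.

(** A step is bounded only on the accumulators really reached from [b0]. This matters for the
    dynamic program, whose steps are cheap on the tables that arise during a run but not on
    arbitrary ones. *)
Lemma time_foldT C s b0 :
  (forall s1 x s2, s = s1 ++ x :: s2 ->
     time (f x (foldl (fun b x => value (f x b)) b0 s1)) <= C) ->
  time (foldT f s b0) <= size s * C.+1 + 1.
Proof.
elim: s b0 => [|x s IHs] b0 fC //=.
have fx : time (f x b0) <= C by apply: (fC [::] x s).
have := IHs (value (f x b0)); rewrite /bind /time /value /= in fx *.
move=> IH; have {IH} := IH _ => IH.
suff : (foldT f s (f x b0).1).2 <= size s * C.+1 + 1 by lia.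
by apply: IH => s1 y s2 Ds; apply: (fC (x :: s1) y s2); rewrite Ds.
Qed.

End Folds.

Section Lists.
Variable A : Type.

Lemma value_filterT (p : A -> timed bool) s :
  value (filterT p s) = [seq x <- s | value (p x)].
Proof. by elim: s => //= x s IHs; rewrite -IHs. Qed.

Lemma time_filterT (p : A -> timed bool) C s :
  (forall x, time (p x) <= C) -> time (filterT p s) <= size s * C.+1 + 1.
Proof.
move=> pC; elim: s => //= x s; have := pC x.
by rewrite /bind /time /value /=; lia.
Qed.

Lemma value_allT (p : A -> timed bool) s :
  value (Defs.allT p s) = all (fun x => value (p x)) s.
Proof. by elim: s => //= x s IHs; rewrite -IHs. Qed.

Lemma time_allT (p : A -> timed bool) C s :
  (forall x, time (p x) <= C) -> time (Defs.allT p s) <= size s * C.+1 + 1.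
Proof.
move=> pC; elim: s => //= x s; have := pC x.
by rewrite /bind /time /value /=; lia.
Qed.

End Lists.

Lemma value_unionT (A : Type) (s1 s2 : seq A) : value (unionT s1 s2) = rev s1 ++ s2.
Proof.
rewrite /unionT value_foldT /=; elim: s1 s2 => //= x s IHs s2.
by rewrite IHs rev_cons cat_rcons.
Qed.

Lemma time_unionT (A : Type) (s1 s2 : seq A) : time (unionT s1 s2) <= size s1 * 2 + 1.
Proof. exact: time_foldT. Qed.

Lemma value_eq_seqT (T : eqType) (s1 s2 : seq T) :
  value (eq_seqT s1 s2) = (s1 == s2).
Proof.
elim: s1 s2 => [|x s1 IHs] [|y s2] //=; rewrite eqseq_cons.
by case: eqP => //= _; rewrite -IHs.
Qed.

Lemma time_eq_seqT (T : eqType) (s1 s2 : seq T) :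
  time (eq_seqT s1 s2) <= (size s1).+1.
Proof.
elim: s1 s2 => [|x s1 IHs] [|y s2] //=; case: eqP => //= _.
by have := IHs s2; rewrite /time /=; lia.
Qed.

(** Every subsequence of [l] is cut out by a bit mask of length [size l]. This is the source of the
    exponential in the number of states of a table. *)
Lemma size_uniq_subseqs (T : eqType) (ss : seq (seq T)) (l : seq T) :
  uniq ss -> all (subseq^~ l) ss -> size ss <= 2 ^ size l.
Proof.
move=> uss sub_l.
pose masks := [seq mask (tval t) l | t : (size l).-tuple bool].
have /(uniq_leq_size uss) : {subset ss <= masks}.
  move=> s /(allP sub_l)/subseqP[m szm ->].
  have szm' : size m == size l by apply/eqP.
  by apply/mapP; exists (Tuple szm') => //; rewrite mem_enum.
by rewrite size_map -cardE card_tuple card_bool.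
Qed.

Lemma pairwise_catl (T : Type) (r : rel T) (l1 l2 : seq T) :
  pairwise r (l1 ++ l2) -> pairwise r l1.
Proof. by rewrite pairwise_cat => /and3P[]. Qed.

(** * Adjacency, counting and weights in a network *)

Section Geometry.
Variables (R : realFieldType) (d omega n : nat) (G : los_network R d omega n).
Implicit Types (u v : G).

Lemma los_edge_irr v : los_edge v v = false.
Proof.
rewrite los_edgeE /share_line_of_sight; apply/negbTE/nandP; left.
by rewrite (eq_card0 _) // => h; rewrite inE eqxx.
Qed.

Lemma los_edge_sym u v : los_edge u v = los_edge v u.
Proof.
rewrite !los_edgeE /share_line_of_sight /manhattan; congr (_ && (_ < _)).
  by congr (_ == _); apply: eq_card => h; rewrite !inE eq_sym.
by apply: eq_bigr => h _; rewrite distnC.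
Qed.

Lemma los_edge_near u v (h : 'I_d) : los_edge u v ->
  `|tnth (los_embed u) h - tnth (los_embed v) h| < omega.
Proof.
rewrite los_edgeE => /andP[_]; apply: leq_ltn_trans.
by rewrite /manhattan (bigD1 h) //= leq_addr.
Qed.

Lemma los_edge_line u v : los_edge u v ->
  exists h : 'I_d, forall h', h' != h ->
    tnth (los_embed u) h' = tnth (los_embed v) h'.
Proof.
rewrite los_edgeE => /andP[/cards1P[h Dh] _]; exists h => h' neq_h.
by apply/eqP; apply: contraNT neq_h => ?; rewrite -in_set1 -Dh inE.
Qed.

Lemma last_coordE (d_gt0 : 0 < d) v :
  exists2 h : 'I_d, h = d.-1 :> nat & last_coord v = tnth (los_embed v) h.
Proof.
have lt_d : d.-1 < d by rewrite prednK.
exists (Ordinal lt_d) => //; rewrite /last_coord -nth_last size_tuple.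
by rewrite (tnth_nth 0).
Qed.

Lemma los_edge_last_coord u v : 0 < d -> los_edge u v ->
  last_coord v < last_coord u + omega.
Proof.
move=> d_gt0 e; have [h Dh ->] := last_coordE d_gt0 u.
have [h' Dh' ->] := last_coordE d_gt0 v.
have -> : h' = h by apply: val_inj; rewrite /= Dh Dh'.
have := los_edge_near h e; lia.
Qed.

Lemma tnth_embed_grid v h : 0 < tnth (los_embed v) h <= n.
Proof. exact: (allP (los_embed_grid v) _ (mem_tnth h _)). Qed.

(** The offsets from the corner [base] determine a point, so they inject [A] into the functions from
    axes to ['I_m.+1]. The lemma serves both for the whole grid and for the window of a strip. *)
Lemma card_box (A : {set G}) m (base : 'I_d -> nat) :
  (forall v h, v \in A ->
     base h <= tnth (los_embed v) h < base h + m.+1) ->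
  #|A| <= m.+1 ^ d.
Proof.
move=> boxA.
pose f v : {ffun 'I_d -> 'I_m.+1} :=
  [ffun h => inord (tnth (los_embed v) h - base h)].
have f_inj : {in A &, injective f}.
  move=> u v Au Av /ffunP fuv; apply/(@los_embed_inj _ _ _ _ G)/eq_from_tnth => h.
  have := congr1 val (fuv h); rewrite !ffunE /=.
  by have := boxA u h Au; have := boxA v h Av => ? ?; rewrite !inordK; lia.
have <- : #|{ffun 'I_d -> 'I_m.+1}| = m.+1 ^ d by rewrite card_ffun !card_ord.
by rewrite -(card_in_imset f_inj) max_card.
Qed.

Lemma card_network : #|G| <= n.+1 ^ d.
Proof.
rewrite -cardsT; apply: (card_box (base := fun=> 0)) => v h _.
by have := tnth_embed_grid v h; lia.
Qed.

Lemma independent_cons v (s : seq G) :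
  independent [set x in v :: s] =
  all (fun u => ~~ los_edge u v) s && independent [set x in s].
Proof.
apply/forall_inP/andP => [ind|[/allP nvs /forall_inP ind]].
  split.
    apply/allP => u us; have := ind u; rewrite inE mem_behead //=.
    by move=> /(_ isT)/forall_inP/(_ v); rewrite inE mem_head => /(_ isT).
  apply/forall_inP => u; rewrite inE => us; apply/forall_inP => w.
  rewrite inE => ws; have := ind u; rewrite inE mem_behead //.
  by move=> /(_ isT)/forall_inP/(_ w); rewrite inE mem_behead // => /(_ isT).
move=> u; rewrite !inE => /orP[/eqP-> | us]; apply/forall_inP => w;
  rewrite !inE => /orP[/eqP-> | ws]; rewrite ?los_edge_irr //.
- by rewrite los_edge_sym nvs.
- exact: nvs.
- have := ind u; rewrite inE us => /(_ isT)/forall_inP/(_ w).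
  by rewrite inE ws => /(_ isT).
Qed.

Lemma independentS (I J : {set G}) :
  I \subset J -> independent J -> independent I.
Proof.
move=> /subsetP sIJ /forall_inP ind; apply/forall_inP => u /sIJ/ind.
by move=> /forall_inP indu; apply/forall_inP => v /sIJ/indu.
Qed.

Lemma weight_seq (s : seq G) :
  uniq s -> (weight [set x in s] = \sum_(x <- s) los_weight x)%R.
Proof.
by move=> us; rewrite /weight big_uniq //=; apply: eq_bigl => x; rewrite inE.
Qed.

Lemma subset_weight (I J : {set G}) :
  I \subset J -> (weight I <= weight J)%R.
Proof.
move=> /setIidPr sIJ; rewrite /weight (big_setID I (A := J)) /= sIJ lerDl.
by apply: sumr_ge0 => x _; rewrite ltW // los_weight_gt0.
Qed.

Lemma weightU_le (I J : {set G}) : (weight (I :|: J) <= weight I + weight J)%R.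
Proof.
rewrite /weight (big_setID I (A := I :|: J)) /= setUK setDUl setDv set0U.
by rewrite lerD2l subset_weight // subsetDl.
Qed.

End Geometry.

(** * Strips as fibres of the block index, and parity across edges *)

Section Blocks.
Variable k : nat.
Hypothesis k_gt0 : 0 < k.

Lemma ceil_div_gt0 x : 0 < x -> 0 < ceil_div x k.
Proof. by move=> x0; rewrite /ceil_div divn_gt0 //; lia. Qed.

Lemma leq_ceil_div x y : x <= y -> ceil_div x k <= ceil_div y k.
Proof. by move=> le_xy; rewrite leq_div2r // leq_add2r. Qed.

(** Adding [k] to the argument raises the rounded quotient by exactly one, and the quotient is
    monotone. *)
Lemma ceil_div_near (x y : nat) :
  `|x - y| <= k -> `|ceil_div x k - ceil_div y k| <= 1.
Proof.
have step a b : b <= a + k -> ceil_div b k <= ceil_div a k + 1.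
  move=> le_ba; rewrite addnC /ceil_div -divnMDl // mul1n.
  by apply: leq_div2r; lia.
by move=> dxy; have := step x y; have := step y x; lia.
Qed.

Lemma ceil_div_bounds x : 0 < x ->
  k * (ceil_div x k - 1) < x <= k * ceil_div x k.
Proof.
move: (divn_eq (x + k.-1) k) (ltn_pmod (x + k.-1) k_gt0).
rewrite -/(ceil_div x k); nia.
Qed.

(** Turns membership in a block into an equation, so that strips become fibres of a map. Positivity
    of [i] excludes the entry 0, which truncated subtraction would identify with the entry 1. *)
Lemma mem_block i x : 0 < i -> 0 < x ->
  (x \in [seq k * (i - 1) + j | j <- iota 1 k]) = (i == ceil_div x k).
Proof.
move=> i0 x0; apply/mapP/eqP => [[j]|Di].
  rewrite mem_iota => /andP[j0 jk] ->; rewrite /ceil_div.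
  have -> : k * (i - 1) + j + k.-1 = i * k + j.-1 by nia.
  by rewrite divnMDl // divn_small; lia.
have := ceil_div_bounds x0; rewrite -Di => bounds.
by exists (x - k * (i - 1)); [rewrite mem_iota; nia | lia].
Qed.

End Blocks.

Definition block_index (d k : nat) (p : d.-tuple nat) : seq nat :=
  [seq ceil_div x k | x <- take d.-1 p].

Lemma size_block_index d k (p : d.-tuple nat) : size (block_index k p) = d.-1.
Proof. by rewrite size_map size_take size_tuple; case: ltnP; lia. Qed.

Lemma nth_block_index d k (p : d.-tuple nat) (h : 'I_d) : h < d.-1 ->
  nth 0 (block_index k p) h = ceil_div (tnth p h) k.
Proof.
move=> lt_h; rewrite (nth_map 0) ?nth_take ?(tnth_nth 0) //.
by have := size_block_index k p; rewrite size_map => ->.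
Qed.

Lemma all_take (T : Type) (a : pred T) m (s : seq T) :
  all a s -> all a (take m s).
Proof. by rewrite -{1}(cat_take_drop m s) all_cat => /andP[]. Qed.

Lemma in_strip_block_index (d n k : nat) (i : seq nat) (p : d.-tuple nat) :
  0 < k -> strip_index d n k i -> in_grid n p ->
  in_strip k i p = (i == block_index k p).
Proof.
move=> k_gt0 /andP[_ pos_i] /(all_take d.-1).
rewrite /in_strip /block_index; elim: i (take _ _) pos_i => [|a i IHi] [|x t] //=.
move=> /andP[/andP[a0 _] /IHi{}IHi] /andP[/andP[x0 _] /IHi->].
by rewrite mem_block // eqseq_cons.
Qed.

Lemma strip_index_block_index (d n k : nat) (p : d.-tuple nat) :
  0 < k -> in_grid n p -> strip_index d n k (block_index k p).
Proof.
move=> k_gt0 /(all_take d.-1) pos_p; rewrite /strip_index size_block_index eqxx.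
rewrite all_map; apply: sub_all pos_p => x /= /andP[x0 xn].
by rewrite ceil_div_gt0 // leq_ceil_div.
Qed.

(** Distinct lists that agree away from [j] and are within one at [j] have sums differing by exactly
    one. Position [j] may lie past the end, which covers edges along the last axis: the lists then
    coincide. *)
Lemma odd_sumn_neq (s t : seq nat) j : size s = size t ->
  (forall h, h != j -> nth 0 s h = nth 0 t h) ->
  `|nth 0 s j - nth 0 t j| <= 1 -> s != t ->
  odd (sumn s) != odd (sumn t).
Proof.
elim: s t j => [|x s IHs] [|y t] //= j [sz_st].
case: j => [|j] eq_nth /= near; rewrite eqseq_cons => neq.
  have Dst : s = t by apply: (eq_from_nth (x0 := 0)) => // h _; apply: (eq_nth h.+1).
  move: neq; rewrite Dst eqxx andbT !oddD => neq.
  have [->|->] : x = y.+1 \/ y = x.+1 by lia.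
    by rewrite /=; case: odd; case: odd.
  by rewrite /=; case: odd; case: odd.
have Dxy := eq_nth 0 isT; rewrite /= in Dxy.
rewrite !oddD Dxy (can_eq (addKb _)); apply: (IHs _ j) => //.
  by move=> h neq_h; apply: (eq_nth h.+1).
by move: neq; rewrite Dxy eqxx.
Qed.

Lemma los_edge_block_index (R : realFieldType) (d omega n : nat)
    (G : los_network R d omega n) (u v : G) : 1 < omega -> los_edge u v ->
  let i := block_index omega.-1 (los_embed u) in
  let j := block_index omega.-1 (los_embed v) in
  i != j -> odd (sumn i) != odd (sumn j).
Proof.
move=> om euv i j neq_ij; have [h eq_h] := los_edge_line euv.
have szE (w : G) := size_block_index omega.-1 (los_embed w).
have nthE (w : G) (h' : 'I_d) (lt_h' : h' < d.-1) :=
  nth_block_index omega.-1 (los_embed w) lt_h'.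
apply: (odd_sumn_neq (j := h)) => //; first by rewrite !szE.
  (* Positions from [d.-1] on are outside both indices and read as the default 0. *)
  move=> h' neq_h; case: (ltnP h' d.-1) => [lt_h'|ge_h']; last first.
    by rewrite !nth_default ?szE.
  have lt_d : h' < d by lia.
  by rewrite !(nthE _ (Ordinal lt_d)) // eq_h.
(* If the edge runs along the last axis, position [h] is past the end of both indices. *)
case: (ltnP h d.-1) => [lt_h|ge_h]; last by rewrite !nth_default ?szE // distnn.
rewrite !nthE //; apply: ceil_div_near; first by rewrite -subn1 subn_gt0.
by rewrite -ltnS prednK; [exact: los_edge_near | exact: ltnW].
Qed.

(** * Invariants of the tables of the dynamic program *)

Section DynamicProgram.
Variables (R : realFieldType) (d omega n : nat) (G : los_network R d omega n).
Hypotheses (d_gt0 : 0 < d) (omega_gt0 : 0 < omega).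

Local Notation psol := (partial_solution R G).
Implicit Types (u v : G) (P J s : seq G) (c : psol) (tb : seq psol).

(** The head of [P] is the vertex scanned last, and a vertex [omega] or more behind it can no longer
    meet an edge to come. Before the first vertex nothing is discarded. *)
Definition in_window P u : bool :=
  if P is v :: _ then last_coord v < last_coord u + omega else true.

(* [P] lists the scanned vertices, the most recent one first. *)
Definition sound P c : bool :=
  [&& subseq (ps_set c) P, independent [set x in ps_set c],
      ps_state c == [seq u <- ps_set c | in_window P u]
    & ps_weight c == (\sum_(x <- ps_set c) los_weight x)%R].

(** Distinctness of the states bounds the size of a table; soundness ties each entry to a genuine
    independent set. *)
Definition well_formed P tb : bool :=
  uniq [seq ps_state c | c <- tb] && all (sound P) tb.

Definition covers (q : seq G) (x : R) tb : bool :=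
  has (fun c => (ps_state c == q) && (x <= ps_weight c)%R) tb.

(** The optimality principle: [J] itself need not be stored, only some entry with the same trace on
    the window and at least the same weight, since later choices depend on the trace alone. *)
Definition complete P tb : Prop :=
  forall J, subseq J P -> independent [set x in J] ->
    covers [seq u <- J | in_window P u] (\sum_(x <- J) los_weight x)%R tb.

Lemma value_tabulateT_cons c c' tb :
  value (tabulateT c (c' :: tb)) =
  if ps_state c == ps_state c' then
    (if (ps_weight c' < ps_weight c)%R then c else c') :: tb
  else c' :: value (tabulateT c tb).
Proof.
rewrite -(value_eq_seqT (ps_state c) (ps_state c')) /= /bind /value /=.
by case: (eq_seqT _ _).1.
Qed.

Lemma states_tabulateT c tb :
  [seq ps_state c' | c' <- value (tabulateT c tb)] =
  let q := [seq ps_state c' | c' <- tb] in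
  if ps_state c \in q then q else rcons q (ps_state c).
Proof.
elim: tb => // c' tb IH; rewrite value_tabulateT_cons /= inE.
case: eqP => [Dc|_] /=; first by case: ifP => // _; rewrite Dc.
by rewrite IH /=; case: ifP.
Qed.

Lemma all_tabulateT (a : pred psol) c tb :
  a c -> all a tb -> all a (value (tabulateT c tb)).
Proof.
move=> ac; elim: tb => [|c' tb IH]; first by rewrite /= ac.
rewrite value_tabulateT_cons => /= /andP[ac' atb].
case: eqP => _ /=; last by rewrite ac' IH.
by rewrite atb; case: ifP; rewrite ?ac ?ac'.
Qed.

Lemma tabulateT_covers q x c tb : ps_state c = q -> (x <= ps_weight c)%R ->
  covers q x (value (tabulateT c tb)).
Proof.
move=> Dq le_x; elim: tb => [|c' tb IH]; first by rewrite /= Dq eqxx le_x.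
rewrite value_tabulateT_cons.
case: eqP => [Dc|_] /=; last by rewrite IH orbT.
case: ltP => le_c; first by rewrite Dq eqxx le_x.
by rewrite -Dc Dq eqxx (le_trans le_x le_c).
Qed.

(** An entry is only ever replaced by a heavier one with the same state. *)
Lemma covers_tabulateT q x c tb :
  covers q x tb -> covers q x (value (tabulateT c tb)).
Proof.
rewrite /covers; elim: tb => // c' tb IH; rewrite value_tabulateT_cons /=.
case: (ps_state c =P _) => [Dc|_] /=; last by case/orP=> [->|/IH->]; rewrite ?orbT.
case: ltP => // lt_c; case/orP=> [/andP[Dq le_x]|->]; last by rewrite orbT.
by rewrite Dc Dq (le_trans le_x (ltW lt_c)).
Qed.

Lemma well_formed_tabulateT P c tb :
  sound P c -> well_formed P tb -> well_formed P (value (tabulateT c tb)).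
Proof.
move=> cP /andP[utb tbP]; rewrite /well_formed all_tabulateT // andbT.
rewrite states_tabulateT /=; case: ifP => // c'tb.
by rewrite rcons_uniq c'tb.
Qed.

Lemma time_tabulateT c tb :
  time (tabulateT c tb) <= size tb * (size (ps_state c)).+2 + 1.
Proof.
elim: tb => //= c' tb IH; rewrite /bind /=.
have := time_eq_seqT (ps_state c) (ps_state c').
by rewrite /time /value /= in IH *; case: (eq_seqT _ _).1 => /=; lia.
Qed.

Definition window_state v c : seq G :=
  [seq u <- ps_state c | last_coord v < last_coord u + omega].

Lemma value_window_state v c :
  value (filterT (fun u => charge 1 (last_coord v < last_coord u + omega))
                 (ps_state c)) = window_state v c.
Proof. exact: value_filterT. Qed.

Definition skip_vertex v c : psol :=
  PartialSolution (window_state v c) (ps_weight c) (ps_set c).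

Definition add_vertex v c : psol :=
  PartialSolution (v :: window_state v c) (ps_weight c + los_weight v)%R
                  (v :: ps_set c).

Definition addable v c : bool :=
  all (fun u => ~~ los_edge u v) (window_state v c).

Lemma value_extendT v c tb :
  value (extendT v c tb) =
  let tb1 := value (tabulateT (skip_vertex v c) tb) in
  if addable v c then value (tabulateT (add_vertex v c) tb1) else tb1.
Proof.
rewrite /extendT /bind value_window_state /addable.
rewrite -[all _ _](value_allT (fun u => charge 1 (~~ los_edge u v))).
by rewrite /value /=; case: (Defs.allT _ _).1.
Qed.

(** * Scanning one vertex preserves the invariants *)

Section Step.
Variables (v : G) (P : seq G).
Hypothesis le_v : all (fun u => last_coord u <= last_coord v) P.

Lemma in_window_cons u :
  last_coord v < last_coord u + omega -> in_window P u.
Proof. by case: P le_v => //= w s /andP[le_wv _]; apply: leq_ltn_trans. Qed.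

(** Windows only move forward in the scanning order: whatever lies in the window of [v] already lay
    in that of [P]. Hence trimming the stored state gives the same result as trimming the full
    set. *)
Lemma filter_window J :
  [seq u <- [seq u <- J | in_window P u] | last_coord v < last_coord u + omega]
  = [seq u <- J | last_coord v < last_coord u + omega].
Proof.
rewrite -filter_predI; apply: eq_filter => u /=.
by case: ltnP => //= /in_window_cons.
Qed.

Lemma sound_skip_vertex c : sound P c -> sound (v :: P) (skip_vertex v c).
Proof.
case/and4P=> sub ind /eqP Dst Dw; apply/and4P; split => //=.
  exact: subseq_trans sub (subseq_cons _ _).
by rewrite /window_state Dst filter_window.
Qed.

Lemma in_window_self : last_coord v < last_coord v + omega.
Proof. by rewrite -addn1 leq_add2l. Qed.

(* A vertex outside the window is too far along the last axis to be adjacent to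
   [v]. *)
Lemma addableE c : sound P c ->
  addable v c = all (fun u => ~~ los_edge u v) (ps_set c).
Proof.
case/and4P=> _ _ /eqP Dst _; rewrite /addable /window_state Dst filter_window.
rewrite all_filter; apply: eq_all => u /=; apply/implyP/idP => // noedge.
apply/negP => e; move: (e); apply/negP/noedge.
exact: los_edge_last_coord.
Qed.

Lemma sound_add_vertex c :
  sound P c -> addable v c -> sound (v :: P) (add_vertex v c).
Proof.
move=> cP; rewrite (addableE cP) => free.
case/and4P: cP => sub ind /eqP Dst /eqP Dw; apply/and4P; split => //=.
- by rewrite eqxx.
- by rewrite independent_cons free.
- by rewrite in_window_self /window_state Dst filter_window.
- by rewrite big_cons Dw addrC.
Qed.

Lemma well_formed_extendT c tb : sound P c -> well_formed (v :: P) tb ->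
  well_formed (v :: P) (value (extendT v c tb)).
Proof.
move=> cP tbP; rewrite value_extendT /=.
have tb1P := well_formed_tabulateT (sound_skip_vertex cP) tbP.
case: ifP => // free; apply: well_formed_tabulateT => //.
exact: sound_add_vertex.
Qed.

Lemma covers_extendT q x c tb :
  covers q x tb -> covers q x (value (extendT v c tb)).
Proof.
move=> cov; rewrite value_extendT /=.
by case: ifP => _; do ?apply: covers_tabulateT.
Qed.

Lemma well_formed_foldl_extendT tb tb' :
  all (sound P) tb -> well_formed (v :: P) tb' ->
  well_formed (v :: P) (foldl (fun b c => value (extendT v c b)) tb' tb).
Proof.
elim: tb tb' => //= c tb IH tb' /andP[cP tbP] tb'P.
by apply: IH => //; apply: well_formed_extendT.
Qed.

Lemma covers_foldl_extendT q x tb tb' : covers q x tb' ->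
  covers q x (foldl (fun b c => value (extendT v c b)) tb' tb).
Proof.
elim: tb tb' => // c tb IH tb' cov.
exact/(IH (value (extendT v c tb')))/covers_extendT.
Qed.

(** A single suitable entry of the old table is enough: processing it creates the cover and the
    remaining steps keep it. The table under construction at that moment is arbitrary, hence the
    quantification over [tb'']. *)
Lemma foldl_extendT_covers (a : pred psol) q x tb tb' :
  (forall c tb'', sound P c -> a c -> covers q x (value (extendT v c tb''))) ->
  all (sound P) tb -> has a tb ->
  covers q x (foldl (fun b c => value (extendT v c b)) tb' tb).
Proof.
move=> ext; elim: tb tb' => // c tb IH tb' /= /andP[cP tbP].
case/orP=> [ac|atb]; last exact: IH.
exact/covers_foldl_extendT/ext.
Qed.

Lemma well_formed_scan_vertexT tb : well_formed P tb ->
  well_formed (v :: P) (value (scan_vertexT v tb)).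
Proof.
case/andP=> _ tbP; rewrite /scan_vertexT value_foldT.
exact: well_formed_foldl_extendT.
Qed.

Lemma complete_scan_vertexT tb : v \notin P -> well_formed P tb ->
  complete P tb -> complete (v :: P) (value (scan_vertexT v tb)).
Proof.
move=> vP /andP[_ tbP] tbC J; rewrite /scan_vertexT value_foldT.
(* First the sets that leave [v] out: the entry covering [J'] is extended by [skip_vertex]. *)
have skip J' : subseq J' P -> independent [set x in J'] ->
    covers [seq u <- J' | in_window (v :: P) u] (\sum_(x <- J') los_weight x)%R
      (foldl (fun b c => value (extendT v c b)) [::] tb).
  move=> subJ indJ; apply: foldl_extendT_covers (tbC _ subJ indJ) => //.
  move=> c tb' cP /andP[/eqP Dc le_c]; rewrite value_extendT /=.
  have cov : covers [seq u <- J' | in_window (v :: P) u]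
      (\sum_(x <- J') los_weight x)%R
      (value (tabulateT (skip_vertex v c) tb')).
    by apply: tabulateT_covers => //=; rewrite /window_state Dc filter_window.
  by case: ifP => // _; apply: covers_tabulateT.
case: J => [|u J]; first by move=> _; apply: skip; rewrite ?sub0seq.
(* Unfolding one step of [subseq] decides whether [J] starts with [v]; if it does not, it is a
   subsequence of [P]. *)
rewrite /subseq; case: eqP => [->|_ subJ]; last exact: skip.
rewrite -/subseq => subJ; rewrite independent_cons => /andP[free indJ].
apply: foldl_extendT_covers (tbC _ subJ indJ) => //.
move=> c tb' cP /andP[/eqP Dc le_c]; rewrite value_extendT /= in_window_self.
(* The set stored in [c] may differ from [J], but their traces agree, and the test for adding [v]
   reads only the trace. *)
have -> : addable v c.
  rewrite /addable /window_state Dc filter_window all_filter.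
  by apply: sub_all free => w nw; apply/implyP.
apply: tabulateT_covers => /=; first by rewrite /window_state Dc filter_window.
by rewrite big_cons addrC lerD2r.
Qed.

End Step.

(** * Table sizes and the cost of scanning one vertex *)

Section Time.
Variable W : nat.

Definition narrow P : bool := size [seq u <- P | in_window P u] <= W.

Lemma size_state P c : narrow P -> sound P c -> size (ps_state c) <= W.
Proof.
move=> nP /and4P[sub _ /eqP-> _]; apply: leq_trans nP.
apply: size_subseq; rewrite subseq_filter filter_all.
exact: subseq_trans (filter_subseq _ _) sub.
Qed.

(** The states are distinct subsequences of the current window, which has at most [W] elements. *)
Lemma size_table P tb : narrow P -> well_formed P tb -> size tb <= 2 ^ W.
Proof.
move=> nP /andP[utb tbP]; rewrite -(size_map (@ps_state R G)).
apply: leq_trans (size_uniq_subseqs (l := [seq u <- P | in_window P u]) utb _) _.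
  rewrite all_map; apply: sub_all tbP => c /and4P[sub _ /eqP Dst _] /=.
  rewrite Dst subseq_filter filter_all; exact: subseq_trans (filter_subseq _ _) sub.
by rewrite leq_exp2l.
Qed.

(** The terms pay for trimming the state and testing adjacency ([2 * W + 1] each), for two
    tabulations, and for a final unit. In [W + 3], a state enlarged by [v] has up to [W + 1]
    elements, and [time_tabulateT] adds 2 per cell. *)
Definition extend_cost : nat := 2 * (2 * W + 1) + 2 * (2 ^ W * (W + 3) + 1) + 1.

Lemma time_extendT v P c tb : all (fun u => last_coord u <= last_coord v) P ->
  narrow P -> narrow (v :: P) -> sound P c -> well_formed (v :: P) tb ->
  time (extendT v c tb) <= extend_cost.
Proof.
move=> le_v nP nvP cP tbP; have le_st := size_state nP cP.
have le_win : size (window_state v c) <= W.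
  by apply: leq_trans le_st; rewrite size_filter count_size.
have tb1P := well_formed_tabulateT (sound_skip_vertex le_v cP) tbP.
rewrite /extendT time_bind value_window_state 2!time_bind.
have := time_filterT (C := 1)
  (p := fun u => charge 1 (last_coord v < last_coord u + omega))
  (ps_state c) (fun=> leqnn _).
have := time_allT (C := 1) (p := fun u => charge 1 (~~ los_edge u v))
  (window_state v c) (fun=> leqnn _).
have skip_le : time (tabulateT (skip_vertex v c) tb) <= 2 ^ W * (W + 3) + 1.
  apply: leq_trans (time_tabulateT _ _) _; rewrite leq_add2r.
  by apply: leq_mul; [exact: size_table tbP | rewrite /=; lia].
have add_le : time (tabulateT (add_vertex v c) (value (tabulateT (skip_vertex v c) tb)))
    <= 2 ^ W * (W + 3) + 1.
  apply: leq_trans (time_tabulateT _ _) _; rewrite leq_add2r.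
  by apply: leq_mul; [exact: size_table tb1P | rewrite /=; lia].
move: skip_le add_le; rewrite /skip_vertex /add_vertex /extend_cost.
by case: (value (Defs.allT _ _)); rewrite ?[time (charge _ _)]/=; lia.
Qed.

Lemma time_scan_vertexT v P tb :
  all (fun u => last_coord u <= last_coord v) P ->
  narrow P -> narrow (v :: P) -> well_formed P tb ->
  time (scan_vertexT v tb) <= 2 ^ W * extend_cost.+1 + 1.
Proof.
move=> le_v nP nvP tbP; have le_sz := size_table nP tbP.
apply: leq_trans (time_foldT (C := extend_cost) _) _; last first.
  by rewrite leq_add2r leq_mul2r le_sz orbT.
case/andP: tbP => _ tbP tb1 c tb2 Dtb.
move: tbP; rewrite Dtb all_cat => /and3P[tb1P cP _].
by apply: time_extendT cP _ => //; apply: well_formed_foldl_extendT.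
Qed.
End Time.

(** * The complete scan: correctness and running time *)

Definition scan_order s (ts : seq nat) : seq G :=
  flatten [seq [seq v <- s | last_coord v == t] | t <- ts].

Definition empty_solution : psol := PartialSolution [::] 0%R [::].

Definition scan s : seq psol :=
  foldl (fun tb v => value (scan_vertexT v tb)) [:: empty_solution] s.

Lemma mem_scan_order s ts v :
  (v \in scan_order s ts) = (v \in s) && (last_coord v \in ts).
Proof.
apply/flatten_mapP/andP => [[t t_ts]|[vs ts_v]].
  by rewrite mem_filter => /andP[/eqP-> ->].
by exists (last_coord v); rewrite ?mem_filter ?eqxx.
Qed.

Lemma scan_order_uniq s ts : uniq s -> uniq ts -> uniq (scan_order s ts).
Proof.
move=> us; elim: ts => //= t ts IH /andP[t_ts /IH uts].
rewrite cat_uniq filter_uniq // uts andbT; apply/hasPn => v.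
rewrite mem_scan_order mem_filter => /andP[_ v_ts].
by apply: contraNN t_ts => /andP[/eqP <-].
Qed.

Lemma scan_order_sorted s ts : pairwise leq ts ->
  pairwise (fun u v => last_coord u <= last_coord v) (scan_order s ts).
Proof.
elim: ts => //= t ts IH /andP[/allP le_t /IH sts].
rewrite pairwise_cat sts andbT; apply/andP; split.
  apply/allrelP => u v; rewrite mem_filter mem_scan_order.
  by move=> /andP[/eqP-> _] /andP[_ /le_t].
have /eq_in_pairwise-> // : {in [seq v <- s | last_coord v == t] &,
    (fun u v => last_coord u <= last_coord v) =2 (fun _ _ => true)}.
  by move=> u v; rewrite !mem_filter => /andP[/eqP-> _] /andP[/eqP-> _]; rewrite leqnn.
by elim: [seq v <- s | _] => //= v l ->; rewrite all_predT.
Qed.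

Lemma value_scan_layerT s t tb : value (scan_layerT s t tb) =
  foldl (fun tb v => value (scan_vertexT v tb)) tb [seq v <- s | last_coord v == t].
Proof. by rewrite /scan_layerT value_bind value_foldT value_filterT. Qed.

(** The nested loops over layers and their vertices become one fold over [scan_order], so the
    invariants can be proved by induction on a single list. *)
Lemma foldl_scan_layerT s ts :
  foldl (fun tb t => value (scan_layerT s t tb)) [:: empty_solution] ts =
  scan (scan_order s ts).
Proof.
rewrite /scan; elim: ts [:: _] => // t ts IH tb.
by apply: etrans (IH (value (scan_layerT s t tb))) _; rewrite value_scan_layerT -foldl_cat.
Qed.

Lemma sound_empty P : sound P empty_solution.
Proof.
rewrite /sound /= sub0seq big_nil !eqxx !andbT.
by apply/forall_inP => x; rewrite inE.
Qed.

Lemma scan_valid s : uniq s ->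
  pairwise (fun u v => last_coord u <= last_coord v) s ->
  well_formed (rev s) (scan s) /\ complete (rev s) (scan s).
Proof.
elim/last_ind: s => [_ _|s v IH].
  split; last by case=> //= _ _; rewrite /covers /= big_nil lexx.
  by rewrite /well_formed /= sound_empty.
rewrite rcons_uniq pairwise_rcons => /andP[vs us] /andP[le_v ss].
have [wf cpl] := IH us ss; rewrite rev_rcons /scan foldl_rcons -/(scan s).
rewrite -all_rev in le_v; rewrite -mem_rev in vs.
by split; [apply: well_formed_scan_vertexT | apply: complete_scan_vertexT].
Qed.

(** The predicate [a], later soundness, passes to the result because the result is [c0] or an entry
    of the table. The disjunct on [c0] makes the maximality claim inductive. *)
Lemma foldl_best_of (a : pred psol) tb c0 : a c0 -> all a tb ->
  let best := foldl (fun b c => best_of c b) c0 tb in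
  a best /\ forall q x, covers q x tb || (x <= ps_weight c0)%R -> (x <= ps_weight best)%R.
Proof.
elim: tb c0 => [|c tb IH] c0 ac0 /=; first by split.
case/andP=> ac atb; have ac1 : a (best_of c c0) by rewrite /best_of; case: ifP.
have {IH}[abest IH] := IH _ ac1 atb.
split=> // q x cov; apply: (IH q); rewrite /best_of.
case/orP: cov => [/orP[/andP[_ le_x]|->]|le_x] //.
  by rewrite orbC; case: ltP => [_|le_c]; rewrite ?le_x // (le_trans le_x le_c).
by rewrite orbC; case: ltP => [lt_c|_]; rewrite ?le_x // (le_trans le_x (ltW lt_c)).
Qed.

Lemma strip_dp_on_optimal s : uniq s ->
  uniq (value (strip_dp_on s)) /\
  optimal_independent_in [set v in s] [set v in value (strip_dp_on s)].
Proof.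
move=> us; set o := scan_order s (iota 1 n).
have uo : uniq o by rewrite scan_order_uniq ?iota_uniq.
(* The layers 1 to [n] miss no vertex, because last coordinates lie in the grid. *)
have mem_o v : (v \in o) = (v \in s).
  rewrite mem_scan_order mem_iota add1n ltnS.
  have [h _ ->] := last_coordE d_gt0 v.
  by rewrite (tnth_embed_grid v h) andbT.
have so : pairwise (fun u v => last_coord u <= last_coord v) o.
  by apply/scan_order_sorted; rewrite -(sorted_pairwise leq_trans) iota_sorted.
have [/andP[_ sndo] cplo] := scan_valid uo so.
have -> : value (strip_dp_on s) =
    ps_set (foldl (fun b c => best_of c b) empty_solution (scan o)).
  by rewrite /strip_dp_on !value_bind !value_foldT foldl_scan_layerT.
have [] := foldl_best_of (sound_empty (rev o)) sndo.
set c := foldl _ _ _ => /and4P[sub ind _ /eqP Dw] max_c.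
have uc : uniq (ps_set c) by rewrite (subseq_uniq sub) ?rev_uniq.
split=> //; split=> //.
  by apply/subsetP => v; rewrite !inE => /(mem_subseq sub); rewrite mem_rev mem_o.
(* A competitor [J] is listed in reverse scanning order, which makes it a subsequence of [rev o] and
   so subject to completeness. *)
move=> J /subsetP sJ indJ; pose l := [seq v <- rev o | v \in J].
have DJ : J = [set v in l].
  apply/setP => v; rewrite inE mem_filter mem_rev mem_o.
  by case vJ: (v \in J) => //; have := sJ v vJ; rewrite inE.
have ul : uniq l by rewrite filter_uniq ?rev_uniq.
rewrite weight_seq // -Dw {1}DJ weight_seq //.
apply: max_c; apply/orP; left; apply: cplo; first exact: filter_subseq.
by rewrite -DJ.
Qed.

Lemma narrow_strip i s : 1 < omega -> {subset s <= strip G i} ->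
  strip_index d n omega.-1 i -> uniq s ->
  pairwise (fun u v => last_coord u <= last_coord v) (rev s) ->
  narrow (omega ^ d) s.
Proof.
case: s => [|v s] // om sub_i idx_i us; rewrite rev_cons pairwise_rcons all_rev.
case/andP=> le_v _; rewrite /narrow -(card_uniqP _) ?filter_uniq //.
set A := filter _ _.
have k_gt0 : 0 < omega.-1 by rewrite -subn1 subn_gt0.
have block_i u : u \in v :: s -> block_index omega.-1 (los_embed u) = i.
  move=> /sub_i; rewrite inE (in_strip_block_index k_gt0 idx_i) ?los_embed_grid //.
  by move/eqP.
(* The corner of a box of side [omega]: the first point of the block of [v] along the first axes,
   and [omega - 1] behind [v] along the last one. *)
pose base (h : 'I_d) := if h < d.-1
  then omega.-1 * (ceil_div (tnth (los_embed v) h) omega.-1 - 1) + 1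
  else last_coord v - omega.-1.
have <- : #|[set u in A]| = #|A| by apply: eq_card => u; rewrite inE.
have om_k := prednK (ltnW om); rewrite -[X in X ^ d]om_k.
apply: (card_box (base := base)) => u h.
rewrite inE mem_filter /= => /andP[near u_vs]; rewrite /base.
case: ltnP => lt_h.
  rewrite -(nth_block_index _ _ lt_h) (block_i v) ?mem_head //.
  rewrite -(block_i u u_vs) nth_block_index //.
  have /andP[gt0 _] := tnth_embed_grid u h.
  have := ceil_div_bounds k_gt0 gt0; have := ceil_div_gt0 k_gt0 gt0; nia.
have [h' Dh' Du] := last_coordE d_gt0 u.
have Dh : h' = h by apply: val_inj; rewrite /= Dh'; have := ltn_ord h; lia.
rewrite -Dh -Du; have : last_coord u <= last_coord v.
  by move: u_vs; rewrite inE => /orP[/eqP->|/(allP le_v)].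
lia.
Qed.

Definition scan_vertex_cost : nat :=
  2 ^ (omega ^ d) * (extend_cost (omega ^ d)).+1 + 1.

(** Here [N] bounds the number of vertices: the first summand selects the layer from the whole list,
    the second scans it. *)
Definition scan_layer_cost N : nat := (N * 2 + 1) + (N * scan_vertex_cost.+1 + 1).

Lemma time_strip_dp_on i s : 1 < omega -> {subset s <= strip G i} ->
  strip_index d n omega.-1 i -> uniq s ->
  time (strip_dp_on s) <=
  (n * (scan_layer_cost (n.+1 ^ d)).+1 + 1) + (2 ^ (omega ^ d) * 2 + 1 + 1).
Proof.
move=> om sub_i idx_i us; set W := omega ^ d; set o := scan_order s (iota 1 n).
have uo : uniq o by rewrite scan_order_uniq ?iota_uniq.
have so : pairwise (fun u v => last_coord u <= last_coord v) o.
  by apply/scan_order_sorted; rewrite -(sorted_pairwise leq_trans) iota_sorted.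
(* Every table met during the run is the scan of a prefix of [o], so narrowness and well-formedness
   are established for all prefixes. *)
have narrow_prefix p q : o = p ++ q -> narrow W (rev p).
  move=> Do; apply: (@narrow_strip i) => //; last 2 first.
  - by rewrite rev_uniq; move: uo; rewrite Do cat_uniq => /and3P[].
  - by rewrite revK; move: so; rewrite Do => /pairwise_catl.
  move=> v; rewrite mem_rev => v_p; apply: sub_i.
  have : v \in o by rewrite Do mem_cat v_p.
  by rewrite mem_scan_order => /andP[].
have wf_prefix p q : o = p ++ q -> well_formed (rev p) (scan p).
  move=> Do; have [] // := @scan_valid p.
    by move: uo; rewrite Do cat_uniq => /and3P[].
  by move: so; rewrite Do => /pairwise_catl.
have size_s l : subseq l s -> size l <= n.+1 ^ d.
  move=> /(subseq_uniq)/(_ us) ul; rewrite -(card_uniqP ul).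
  exact: leq_trans (max_card _) (card_network G).
have time_vertex p v q : o = p ++ v :: q ->
    time (scan_vertexT v (scan p)) <= scan_vertex_cost.
  move=> Do; have Do' : o = rcons p v ++ q by rewrite cat_rcons.
  apply: (@time_scan_vertexT _ _ (rev p)).
  - rewrite all_rev; move: so; rewrite Do' => /pairwise_catl.
    by rewrite pairwise_rcons => /andP[].
  - exact: narrow_prefix Do.
  - by rewrite -rev_rcons; apply: narrow_prefix Do'.
  - exact: wf_prefix Do.
rewrite /strip_dp_on !time_bind -/empty_solution addnA -addnA.
have -> : value (foldT (scan_layerT s) (iota 1 n) [:: empty_solution]) = scan o.
  by rewrite value_foldT foldl_scan_layerT.
apply: leq_add; last first.
  rewrite leq_add2r; apply: leq_trans (time_foldT (C := 1) _) _ => //.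
  rewrite leq_add2r leq_mul2r /=.
  have Do : o = o ++ [::] by rewrite cats0.
  exact: size_table (narrow_prefix _ _ Do) (wf_prefix _ _ Do).
rewrite -[X in X * _](size_iota 1 n); apply: time_foldT => ts1 t ts2 Dts.
rewrite foldl_scan_layerT /scan_layerT time_bind value_filterT.
apply: leq_add.
  apply: leq_trans (time_filterT (C := 1) _ _) _ => //.
  by rewrite leq_add2r leq_mul2r size_s.
apply: leq_trans (time_foldT (C := scan_vertex_cost) _) _.
  (* The vertices scanned before [v] are those of the earlier layers followed by [l1], which
     together form a prefix of [o]. *)
  move=> l1 v l2 Dl; rewrite -[foldl _ _ _]foldl_cat.
  apply: (time_vertex _ _ (l2 ++ scan_order s ts2)).
  by rewrite /o Dts /scan_order map_cat flatten_cat /= [X in _ ++ X ++ _]Dl -!catA.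
by rewrite leq_add2r leq_mul2r size_s ?filter_subseq ?orbT.
Qed.

End DynamicProgram.

(** * The dynamic program as an exact polynomial-time strip solver *)

Section StripList.
Variables (R : realFieldType) (d omega n : nat) (G : los_network R d omega n).
Implicit Types i : seq nat.

Lemma value_strip_listT i : value (strip_listT G i) = enum (strip G i).
Proof.
rewrite /strip_listT value_filterT enumT [RHS]/enum_mem.
by apply: eq_filter => v; rewrite -[RHS]/(v \in strip G i) inE.
Qed.

Lemma time_strip_listT i :
  time (strip_listT G i) <= n.+1 ^ d * (d * omega.-1).+1 + 1.
Proof.
apply: leq_trans (time_filterT (C := d * omega.-1) _ _) _ => //.
by rewrite -cardE leq_add2r leq_mul2r card_network orbT.
Qed.

End StripList.

Lemma exact_strip_dp (R : realFieldType) (d omega : nat) :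
  0 < d -> 0 < omega -> exact_strip_solver (strip_dp R d omega).
Proof.
move=> d_gt0 om_gt0 n G i idx_i /=; rewrite value_strip_listT.
have := strip_dp_on_optimal d_gt0 om_gt0 (enum_uniq (strip G i)).
by rewrite set_enum.
Qed.

Lemma polytime_strip_dp (R : realFieldType) (d omega : nat) :
  0 < d -> 1 < omega -> polytime_strip_solver (strip_dp R d omega).
Proof.
move=> d_gt0 om.
suff [p le_p] : poly_bounded (fun n =>
    (n * (scan_layer_cost d omega (n.+1 ^ d)).+1 + 1) + (2 ^ (omega ^ d) * 2 + 1 + 1)).
  exists p => n G i idx_i; apply: leq_trans (le_p n).
  rewrite value_strip_listT; apply: (time_strip_dp_on d_gt0 (ltnW om) om _ idx_i).
    by move=> v; rewrite mem_enum.
  exact: enum_uniq.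
rewrite /scan_layer_cost; solve_poly_bounded.
Qed.

(** * Enumeration of the strip indices *)

Section IndexVectors.
Variable m : nat.

(** The accumulators reverse the order of the products, so equality holds up to permutation. This
    suffices for size, absence of duplicates and membership. *)
Lemma value_index_vectorsT_step (ts : seq (seq nat)) s acc :
  perm_eq
    (value (foldT (fun a acc =>
       foldT (fun t acc' => charge 1 ((a :: t) :: acc')) ts acc) s acc))
    ([seq a :: t | a <- s, t <- ts] ++ acc).
Proof.
rewrite value_foldT; elim: s acc => //= a s IH acc.
apply: perm_trans (IH _) _; rewrite value_foldT -catA perm_sym perm_catCA.
rewrite perm_cat2l perm_sym.
elim: ts {IH} acc => //= t ts IH acc; apply: perm_trans (IH _) _.
exact: (permEl (perm_catCA _ [:: a :: t] acc)).
Qed.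

Lemma index_vectorsT_perm r :
  perm_eq (value (index_vectorsT m r.+1))
    [seq a :: t | a <- iota 1 m, t <- value (index_vectorsT m r)].
Proof.
by apply: perm_trans (value_index_vectorsT_step _ _ _) _; rewrite cats0.
Qed.

Lemma size_index_vectorsT r : size (value (index_vectorsT m r)) = m ^ r.
Proof.
elim: r => // r IH; rewrite (perm_size (index_vectorsT_perm r)).
by rewrite size_allpairs size_iota IH expnS.
Qed.

Lemma index_vectorsT_uniq r : uniq (value (index_vectorsT m r)).
Proof.
elim: r => // r IH; rewrite (perm_uniq (index_vectorsT_perm r)).
by apply: allpairs_uniq; rewrite ?iota_uniq // => -[a t] [b u] _ _ [-> ->].
Qed.

Lemma mem_index_vectorsT r i :
  (i \in value (index_vectorsT m r)) =
  (size i == r) && all (fun a => 0 < a <= m) i.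
Proof.
elim: r i => [|r IH] i; first by rewrite inE; case: i.
rewrite (perm_mem (index_vectorsT_perm r)); apply/allpairsP/idP.
  move=> [[a t] /= []]; rewrite mem_iota IH add1n ltnS.
  by move=> a_m /andP[/eqP<- t_m] ->; rewrite /= eqxx a_m.
case: i => //= a t /andP[sz /andP[a_m t_m]]; exists (a, t) => /=.
by rewrite mem_iota add1n ltnS IH a_m t_m -eqSS sz.
Qed.

End IndexVectors.

(** The algorithm takes [m] to be a rounded quotient of [n], which is not a polynomial in [n]; a
    bound uniform in all [m <= n] avoids the issue. *)
Lemma time_index_vectorsT r : exists2 f, poly_bounded f &
  forall m n, m <= n -> time (index_vectorsT m r) <= f n.
Proof.
elim: r => [|r [f fP le_f]]; first by exists (fun=> 1) => //; apply: poly_bounded_const.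
exists (fun n => f n + (n * (n ^ r * 2 + 1).+1 + 1)); first by solve_poly_bounded.
move=> m n le_mn.
rewrite -[time _]/(time (index_vectorsT m r) + time (foldT _ _ _)).
apply: leq_add; first exact: le_f.
apply: leq_trans (time_foldT (C := m ^ r * 2 + 1) _) _.
  by move=> s1 a s2 _; rewrite -size_index_vectorsT; apply: time_foldT.
have : m ^ r <= n ^ r by case: (r) => // r'; rewrite leq_exp2r.
by rewrite size_iota leq_add2r => le_r; apply: leq_mul => //; lia.
Qed.

(** * Union of the strip solutions of one parity, approximation factor and total time *)

Section Collect.
Variables (R : realFieldType) (d omega : nat) (solve : strip_solver R d omega).
Hypotheses (omega_gt1 : 1 < omega) (solveP : exact_strip_solver solve).
Variables (n : nat) (G : los_network R d omega n).
Implicit Types (i : seq nat) (s : seq (seq nat)) (acc : seq G * seq G).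

Local Notation blk v := (block_index omega.-1 (los_embed v)).

Definition strip_solution i : seq G := value (solve (value (strip_listT G i))).

(** Indexing the two components by a boolean, [true] for odd, lets one argument treat both
    parities. *)
Definition parity_part (b : bool) acc : seq G := if b then acc.1 else acc.2.

Lemma parity_part_collect b s acc :
  perm_eq
    (parity_part b (foldl (fun acc i => value (collect_stripT solve i acc)) acc s))
    (flatten [seq strip_solution i | i <- s & odd (sumn i) == b]
       ++ parity_part b acc).
Proof.
elim: s acc => // i s IH acc; apply: perm_trans (IH _) _ => {IH}.
have -> : value (collect_stripT solve i acc) =
    if odd (sumn i) then (rev (strip_solution i) ++ acc.1, acc.2)
    else (acc.1, rev (strip_solution i) ++ acc.2).
  rewrite /collect_stripT !value_bind [value (charge _ _)]/=.
  by case: odd; rewrite value_bind value_unionT.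
rewrite /=; case: odd; case: b => //=;
  by rewrite -catA perm_sym perm_catCA perm_cat2l perm_cat2r perm_sym perm_rev.
Qed.

Section Parity.
Variables (b : bool) (s : seq (seq nat)).
Hypotheses (s_uniq : uniq s) (s_index : all (strip_index d n omega.-1) s).
Hypothesis s_parity : all (fun i => odd (sumn i) == b) s.

Definition strip_union : seq G := flatten [seq strip_solution i | i <- s].

Lemma omega_pred_gt0 : 0 < omega.-1.
Proof. by rewrite -subn1 subn_gt0. Qed.

Lemma mem_strip i v : strip_index d n omega.-1 i -> (v \in strip G i) = (i == blk v).
Proof.
by move=> idx_i; rewrite inE (in_strip_block_index omega_pred_gt0 idx_i) ?los_embed_grid.
Qed.

Lemma strip_solution_block i v : strip_index d n omega.-1 i ->
  v \in strip_solution i -> blk v = i.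
Proof.
move=> idx_i v_i; have [_ [/subsetP sub _ _]] := solveP G idx_i.
by apply/esym/eqP; rewrite -mem_strip // sub // inE.
Qed.

(** A vertex determines its block index, so solutions of different strips are disjoint. This is what
    allows the weight of the union to be computed as a sum over the list. *)
Lemma strip_union_uniq : uniq strip_union.
Proof.
rewrite /strip_union; elim: (s) s_uniq s_index => //= i s' IH.
move=> /andP[i_s' us'] /andP[idx_i idx_s'].
rewrite cat_uniq IH // andbT; have [-> _] := solveP G idx_i.
apply/hasPn => v /flatten_mapP[j j_s' v_j]; apply: contraNN i_s' => v_i.
have := allP idx_s' _ j_s' => idx_j.
by rewrite -(strip_solution_block idx_i v_i) (strip_solution_block idx_j v_j).
Qed.

Lemma strip_union_independent : independent [set v in strip_union].
Proof.
apply/forall_inP => u; rewrite inE => /flatten_mapP[i i_s u_i].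
apply/forall_inP => v; rewrite inE => /flatten_mapP[j j_s v_j].
have idx_i := allP s_index _ i_s; have idx_j := allP s_index _ j_s.
have Du := strip_solution_block idx_i u_i; have Dv := strip_solution_block idx_j v_j.
case: (eqVneq i j) => [Dij|neq_ij].
  have [_ [_ /forall_inP ind _]] := solveP G idx_i.
  have := ind u; rewrite inE => /(_ u_i)/forall_inP/(_ v).
  by rewrite inE {1}Dij => /(_ v_j).
(* An edge between different strips would force opposite parities, while all indices in [s] have
   parity [b]. *)
apply/negP => e; have := los_edge_block_index omega_gt1 e.
rewrite Du Dv => /(_ neq_ij); rewrite (eqP (allP s_parity _ i_s)).
by rewrite (eqP (allP s_parity _ j_s)) eqxx.
Qed.

(** The part of [J] in each strip is independent there, so it weighs at most the solution of that
    strip; subadditivity of the weight adds up these bounds. *)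
Lemma weight_strip_union (J : {set G}) : independent J ->
  (weight [set v in J | blk v \in s] <= \sum_(v <- strip_union) los_weight v)%R.
Proof.
move=> indJ; rewrite /strip_union; elim: (s) s_index => [|i s' IH] /=.
  move=> _; rewrite big_nil /weight big1 // => v.
  by rewrite inE andbF.
case/andP=> idx_i idx_s'; rewrite big_cat /=.
have [usol [_ _ opt]] := solveP G idx_i.
set A := [set v in J | blk v == i].
have optA : (weight A <= \sum_(v <- strip_solution i) los_weight v)%R.
  rewrite -(weight_seq usol); apply: opt.
    by apply/subsetP => v; rewrite inE mem_strip // eq_sym => /andP[].
  by apply: independentS indJ; apply/subsetP => v; rewrite inE => /andP[].
apply: le_trans (lerD optA (IH idx_s')).
apply: le_trans (subset_weight _) (weightU_le _ _).
apply/subsetP => v; rewrite !inE => /andP[-> /=].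
by case: eqP.
Qed.

End Parity.

Definition block_vectors : seq (seq nat) :=
  value (index_vectorsT (ceil_div n omega.-1) d.-1).

Definition collected : seq G * seq G :=
  foldl (fun acc i => value (collect_stripT solve i acc)) ([::], [::]) block_vectors.

Lemma mem_block_vectors i : (i \in block_vectors) = strip_index d n omega.-1 i.
Proof. exact: mem_index_vectorsT. Qed.

Lemma parity_part_optimal b : let L := parity_part b collected in
  [/\ uniq L, independent [set v in L] &
      forall J : {set G}, independent J ->
        (weight [set v in J | odd (sumn (blk v)) == b] <= weight [set v in L])%R].
Proof.
move=> L; pose s := [seq i <- block_vectors | odd (sumn i) == b].
have us : uniq s by rewrite filter_uniq // index_vectorsT_uniq.
have idx_s : all (strip_index d n omega.-1) s.
  by apply/allP => i; rewrite mem_filter mem_block_vectors => /andP[].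
have par_s : all (fun i => odd (sumn i) == b) s by apply: filter_all.
have pL : perm_eq L (strip_union s).
  apply: perm_trans (parity_part_collect _ _ _) _.
  by case: b @s {us idx_s par_s L} => s; rewrite cats0.
have uL : uniq L by rewrite (perm_uniq pL) strip_union_uniq.
have DL : [set v in L] = [set v in strip_union s].
  by apply/setP => v; rewrite !inE (perm_mem pL).
split=> // [|J indJ]; first by rewrite DL (strip_union_independent idx_s par_s).
rewrite (weight_seq uL) (perm_big _ pL) /=.
apply: le_trans (weight_strip_union idx_s indJ).
apply: subset_weight; apply/subsetP => v; rewrite !inE => /andP[-> odd_v] /=.
(* Every vertex lies in an enumerated strip, since its block index is a valid strip index. *)
rewrite mem_filter odd_v mem_block_vectors strip_index_block_index //.
  exact: omega_pred_gt0.
exact: los_embed_grid.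
Qed.

Lemma value_StripIndependentSet : value (StripIndependentSet solve G) =
  parity_part (\sum_(v <- collected.2) los_weight v
               <= \sum_(v <- collected.1) los_weight v)%R collected.
Proof.
have weightTE (l : seq G) : (value (weightT l) = \sum_(v <- l) los_weight v)%R.
  rewrite /weightT value_foldT; elim/last_ind: l => [|l v IH].
    by rewrite big_nil.
  by rewrite foldl_rcons big_rcons /= -IH addrC.
rewrite /StripIndependentSet !value_bind !weightTE value_foldT -/block_vectors -/collected.
by rewrite [LHS]/=; case: ifP.
Qed.

Lemma StripIndependentSet_approx :
  let S := [set v in value (StripIndependentSet solve G)] in
  independent S /\ (max_independent_weight G / 2%:R <= weight S)%R.
Proof.
rewrite value_StripIndependentSet /=.
have [u1 ind1 opt1] := parity_part_optimal true.
have [u2 ind2 opt2] := parity_part_optimal false.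
rewrite /= in u1 u2 ind1 ind2 opt1 opt2.
rewrite -(weight_seq u1) -(weight_seq u2).
set S := [set v in _].
(* The heavier of the two unions has at least half of their total weight. *)
have [indS le_S] : independent S /\
    (weight [set v in collected.1] + weight [set v in collected.2] <= weight S *+ 2)%R.
  rewrite /S; case: lerP => [le21|/ltW le12] /=; split=> //.
    by rewrite mulr2n lerD2l.
  by rewrite mulr2n lerD2r.
split=> //; rewrite ler_pdivrMr ?ltr0n // mulr_natr.
(* The default value 0 of the maximum gives a separate goal, settled by positivity of the
   weights. *)
apply: bigmax_le => [|J indJ].
  by rewrite mulrn_wge0 // sumr_ge0 // => v _; rewrite ltW ?los_weight_gt0.
apply: le_trans (le_trans (lerD (opt1 J indJ) (opt2 J indJ)) le_S).
apply: le_trans (subset_weight _) (weightU_le _ _).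
by apply/subsetP => v vJ; rewrite !inE vJ; case: odd.
Qed.

Lemma size_uniq_network (l : seq G) : uniq l -> size l <= n.+1 ^ d.
Proof. by move=> /card_uniqP <-; apply: leq_trans (max_card _) (card_network G). Qed.

Lemma leq_ceil_div_self : ceil_div n omega.-1 <= n.
Proof.
rewrite /ceil_div -ltnS ltn_divLR ?omega_pred_gt0 //.
by have := omega_pred_gt0; nia.
Qed.

(** With [N] bounding the number of vertices and [T] the solver, the terms pay for listing the
    strip, solving it, computing the parity of its index, and merging. *)
Definition collect_cost N T : nat :=
  (N * (d * omega.-1).+1 + 1) + (T + (d + ((N * 2 + 1) + 1))).

Lemma time_StripIndependentSet T f :
  (forall i, strip_index d n omega.-1 i ->
     time (solve (value (strip_listT G i))) <= T) ->
  time (index_vectorsT (ceil_div n omega.-1) d.-1) <= f ->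
  time (StripIndependentSet solve G) <=
  f + ((n ^ d.-1 * (collect_cost (n.+1 ^ d) T).+1 + 1) +
       ((n.+1 ^ d * 2 + 1) + ((n.+1 ^ d * 2 + 1) + 1))).
Proof.
move=> le_T le_f; rewrite /StripIndependentSet !time_bind value_foldT.
rewrite -/block_vectors -/collected.
have [u1 _ _] := parity_part_optimal true.
have [u2 _ _] := parity_part_optimal false.
have time_weightT (l : seq G) : uniq l -> time (weightT l) <= n.+1 ^ d * 2 + 1.
  move=> ul; apply: leq_trans (time_foldT (C := 1) _) _ => //.
  by rewrite leq_add2r leq_mul2r size_uniq_network.
apply: leq_add => //; apply: leq_add; last first.
  by apply: leq_add; [exact: time_weightT u1|apply: leq_add; [exact: time_weightT u2|]].
apply: leq_trans (time_foldT (C := collect_cost (n.+1 ^ d) T) _) _.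
  move=> s1 i s2 Ds; set acc := foldl _ _ _.
  have idx_i : strip_index d n omega.-1 i.
    by rewrite -mem_block_vectors Ds mem_cat mem_head orbT.
  (* Exactness includes that the output has no duplicates, which bounds its length and hence the
     cost of merging it. *)
  have [usol _] := solveP G idx_i.
  rewrite /collect_stripT !time_bind !leq_add ?time_strip_listT ?le_T //.
  have le_u (l : seq G) : time (unionT (strip_solution i) l) <= n.+1 ^ d * 2 + 1.
    apply: leq_trans (time_unionT _ _) _.
    by rewrite leq_add2r leq_mul2r size_uniq_network.
  by case: (value _); rewrite time_bind leq_add ?le_u.
rewrite leq_add2r leq_mul2r size_index_vectorsT; apply/orP; right.
by case: (d.-1) => // e; rewrite leq_exp2r // leq_ceil_div_self.
Qed.

End Collect.

Lemma StripIndependentSet_polytime (R : realFieldType) (d omega : nat)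
    (solve : strip_solver R d omega) : 1 < omega ->
  exact_strip_solver solve -> polytime_strip_solver solve ->
  exists p : {poly nat}, forall n (G : los_network R d omega n),
    time (StripIndependentSet solve G) <= p.[n]%R.
Proof.
move=> om solveP [p le_p]; have [f fP le_f] := time_index_vectorsT d.-1.
suff [q le_q] : poly_bounded (fun n =>
    f n + ((n ^ d.-1 * (collect_cost d omega (n.+1 ^ d) p.[n]%R).+1 + 1) +
           ((n.+1 ^ d * 2 + 1) + ((n.+1 ^ d * 2 + 1) + 1)))).
  exists q => n G; apply: leq_trans (le_q n).
  apply: (time_StripIndependentSet om solveP); first exact: le_p.
  exact/le_f/leq_ceil_div_self.
by rewrite /collect_cost; solve_poly_bounded.
Qed.

(** The subroutine enters the argument only through exactness and polynomial running time, so the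
    guarantee is given for every such solver. The first two clauses show that [strip_dp] is one, so
    the guarantee is not vacuous. *)
Theorem theorem6 (R : realFieldType) (d omega : nat)
    (hd : 2 <= d) (homega : 2 < omega) :
  [/\ exact_strip_solver (strip_dp R d omega),
      polytime_strip_solver (strip_dp R d omega)
    & forall solve : strip_solver R d omega,
        exact_strip_solver solve ->
        polytime_strip_solver solve ->
        polytime_approximation 2%:R%R
          (fun n (G : los_network R d omega n) => StripIndependentSet solve G)].
Proof.
have d_gt0 : 0 < d by apply: ltnW.
have om : 1 < omega by apply: ltnW.
split; first by apply: exact_strip_dp => //; apply: ltnW.
  exact: polytime_strip_dp.
move=> solve solveP solve_poly; split.
  exact: StripIndependentSet_polytime.
by move=> n G; apply: StripIndependentSet_approx.
Qed.
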